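(* For all prime powers $q$ and all integers $n,\ell\geq 1$, the attenuated-space association scheme on $\Omega_1=\Omega_1(q,n,\ell)$ satisfies $$\operatorname{cdim}(\Omega_1)=(q^\ell-1)\,\frac{q^n-1}{q-1}.$$
   Context: Attenuated-space scheme: let $V$ be an $(n+\ell)$-dimensional vector space over $\mathbb F_q$ and $E\leq V$ a fixed $\ell$-dimensional subspace. For $1\leq m\leq n$ let $$\Omega_m=\{X\leq V:\dim X=m,\ X\cap E=0\}.$$ Let $W$ be a complement to $E$ in $V$ and $\pi:V\to W$ the projection along $E$; for $X\in\Omega_m$, $\pi(X)$ is an $m$-dimensional subspace of $W$. The set $\Omega_m$ carries a symmetric association scheme whose relations are indexed by pairs $(i,j)$: $(X,Y)\in R_{(i,j)}$ if and only if $\dim(\pi(X)\cap\pi(Y))=m-i$ and $\dim(X\cap Y)=m-i-j$. A pair $(i,j)$ is regarded as a single relation label. Class dimension: for a symmetric association scheme on a finite set $\Omega$ and $s,x\in\Omega$, let $i(s,x)$ be the label of the unique relation containing $(s,x)$. A set $S\subseteq\Omega$ is class-resolving if $x\mapsto(i(s,x))_{s\in S}$ is injective on $\Omega$; $\operatorname{cdim}(\Omega)$ is the least size of a class-resolving set. *)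

(* Defs.v *)
From HB Require Import structures.
From mathcomp Require Import all_boot all_order all_algebra.
From mathcomp Require Import zify.

Set Implicit Arguments.
Unset Strict Implicit.
Unset Printing Implicit Defensive.

Import GRing.Theory.
Local Open Scope ring_scope.

(* Some labels may have an empty relation; only the labels that occur matter
   for what follows. *)
Record symScheme (T I : finType) := SymScheme {
  srel : I -> rel T;
  srel_partition : forall x y, exists! i, srel i x y;
  srel_diag : exists i0, forall x y, srel i0 x y = (x == y);
  srel_sym : forall i, symmetric (srel i);
  srel_regular : forall i j k, exists p : nat, forall x y,
    srel k x y -> #|[set z | srel i x z & srel j z y]| = p }.

Section ClassDimension.
Variables (T I : finType) (A : symScheme T I).

Lemma ex_label x y : exists i, srel A i x y.
Proof. by have [i [Hi _]] := srel_partition A x y; exists i. Qed.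

Definition label x y : I := xchoose (ex_label x y).

Lemma label_eq i x y : (label x y == i) = srel A i x y.
Proof.
have Hl := xchooseP (ex_label x y); rewrite -/(label x y) in Hl.
apply/eqP/idP => [<- //|Hi].
have [k [_ Hk]] := srel_partition A x y.
by rewrite -(Hk _ Hl) -(Hk _ Hi).
Qed.

Definition class_resolving (S : {set T}) : bool :=
  injectiveb (fun x : T => [ffun s : {s : T | s \in S} => label (val s) x]).

Lemma class_resolvingP (S : {set T}) :
  reflect (forall x y, {in S, forall s, label s x = label s y} -> x = y)
          (class_resolving S).
Proof.
apply: (iffP (injectiveP _)) => H x y Hxy.
  by apply: H; apply/ffunP=> s; rewrite !ffunE Hxy //; apply: valP.
apply: H => s sS; have /ffunP/(_ (Sub s sS)) := Hxy.
by rewrite !ffunE.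
Qed.

Lemma class_resolvingT : class_resolving setT.
Proof.
apply/class_resolvingP => x y Hxy.
have [i0 Hi0] := srel_diag A.
apply/eqP; rewrite -Hi0 -label_eq -Hxy ?inE // label_eq Hi0; exact: eqxx.
Qed.

Lemma ex_class_resolving :
  exists k, [exists S : {set T}, class_resolving S && (#|S| == k)].
Proof. by exists #|[set: T]|; apply/existsP; exists setT; rewrite class_resolvingT eqxx. Qed.

Definition cdim : nat := ex_minn ex_class_resolving.

End ClassDimension.

Section SubspaceFinite.
Import VectorInternalTheory.
Variables (F : finFieldType) (V : vectType F).
HB.instance Definition _ := [Countable of {vspace V} by <:].
HB.instance Definition _ := [Finite of {vspace V} by <:].
End SubspaceFinite.

Definition complementary (F : fieldType) (V : vectType F) (W E : {vspace V}) :=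
  ((W + E == fullv) && (W :&: E == 0))%VS.

Section Configurations.
Variables (F : fieldType) (V : vectType F) (W E : {vspace V}).
Hypothesis cWE : complementary W E.
Implicit Types X Y : {vspace V}.
Local Notation pi := (daddv_pi W E).

Lemma proj_addv X : (pi @: X + E = X + E)%VS.
Proof.
case/andP: cWE => /eqP WE1 /eqP WE0.
have EW0 : (E :&: W = 0)%VS by rewrite capvC.
have dec v : pi v + daddv_pi E W v = v by rewrite daddv_pi_add // WE1 memvf.
apply/eqP; rewrite eqEsubv !subv_add !addvSr !andbT; apply/andP; split.
  apply/subvP => _ /memv_imgP[v vX ->].
  by rewrite -[pi v](addrK (daddv_pi E W v)) dec memv_add // memvN memv_pi.
by apply/subvP => v vX; rewrite -(dec v) memv_add ?memv_img ?memv_pi.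
Qed.

Lemma proj_cap X Y :
  ((X + E) :&: (Y + E) = (pi @: X :&: pi @: Y) + E)%VS.
Proof.
case/andP: cWE => /eqP WE1 /eqP WE0.
rewrite -(proj_addv X) -(proj_addv Y).
apply/eqP; rewrite eqEsubv; apply/andP; split; last first.
  by rewrite subv_cap !addvS ?capvSl ?capvSr.
apply/subvP => w /memv_capP[/memv_addP[a aX [e eE ->]] /memv_addP[b bY [f fE Hw]]].
have inW U v : v \in (pi @: U)%VS -> v \in W by case/memv_imgP=> u _ ->; apply: memv_pi.
have /eqP : a - b \in (0 : {vspace V})%VS.
  rewrite -WE0 memv_cap memvB ?(inW X a) ?(inW Y b) //=.
  have -> : a - b = f - e by apply/eqP; rewrite subr_eq addrAC eq_sym subr_eq Hw addrC.
  by rewrite memvB.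
rewrite memv0 subr_eq0 => /eqP/eqP ab.
by rewrite memv_add // memv_cap aX ab bY.
Qed.

Lemma dim_proj_cap X Y :
  (\dim (pi @: X :&: pi @: Y) + \dim E)%N = \dim ((X + E) :&: (Y + E)).
Proof.
rewrite proj_cap dimv_disjoint_sum //; apply/eqP; rewrite -subv0.
case/andP: cWE => _ /eqP <-; rewrite capvS //.
apply/subvP => v /memv_capP[/memv_imgP[u _ ->] _]; exact: memv_pi.
Qed.

Lemma dim_proj X : (X :&: E = 0)%VS -> \dim (pi @: X) = \dim X.
Proof.
move=> XE0; have := dim_proj_cap X X.
by rewrite !capvv dimv_disjoint_sum // => /addIn.
Qed.

Lemma dim_half X Y : (X :&: E = 0)%VS ->
  \dim (X :&: (Y + E)) = \dim (pi @: X :&: pi @: Y).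
Proof.
move=> XE0; apply/(@addIn (\dim E)); rewrite dim_proj_cap.
rewrite -dimv_disjoint_sum; last first.
  by apply/eqP; rewrite -subv0 -XE0 capvS ?capvSl.
by rewrite addvC vspace_modl ?addvSr // [(E + X)%VS]addvC.
Qed.

Lemma proj_cap_sub X Y : (X :&: E = 0)%VS ->
  (\dim (X :&: Y) <= \dim (pi @: X :&: pi @: Y))%N.
Proof. by move=> XE0; rewrite -dim_half // dimvS // capvS // addvSl. Qed.

Definition zip_sub (p d : seq V) := [seq z.1 - z.2 | z <- zip p d].

Let adapted_arith (a p x e y t k dX dY dE D N : nat) :
  (x + k = dX -> y + k = dY -> e + p = dE -> p + a = k -> t + D = N ->
  D + k = dE + dX + dY -> a + (p + (p + (x + (e + (y + t))))) <= N)%N.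
Proof. lia. Qed.

(* A basis of V adapted to the configuration (E, X, Y). *)
Lemma adapted_basis X Y : (X :&: E = 0)%VS -> (Y :&: E = 0)%VS ->
  let k : nat := \dim (pi @: X :&: pi @: Y) in
  exists a p d x e y t : seq V,
  [/\ basis_of fullv (a ++ p ++ d ++ x ++ e ++ y ++ t),
      [/\ <<a ++ p ++ x>>%VS = X, <<d ++ e>>%VS = E &
          <<a ++ zip_sub p d ++ y>>%VS = Y] &
      [/\ size a = \dim (X :&: Y), (size a + size p)%N = k, size d = size p,
          (size x + k = \dim X)%N & (size e + size d = \dim E)%N
          /\ (size y + k = \dim Y)%N]].
Proof.
move=> XE0 YE0 k.
pose eps := daddv_pi E Y; pose psi := daddv_pi Y E.
have EY0 : (E :&: Y = 0)%VS by rewrite capvC.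
have sumK v : v \in (Y + E)%VS -> psi v + eps v = v by move=> vYE; apply: daddv_pi_add.
pose A := (X :&: Y)%VS; pose P := (X :&: (Y + E))%VS; pose Q := (Y :&: (X + E))%VS.
have dP : \dim P = k by apply: dim_half.
have dQ : \dim Q = k by rewrite dim_half // capvC.
have AP : (A <= P)%VS by rewrite capvS // addvSl.
have PX : (P <= X)%VS by apply: capvSl.
pose a := vbasis A; pose p := vbasis (P :\: A); pose x := vbasis (X :\: P).
pose d := map eps p.
have P'P : (P :\: A <= P)%VS by apply: diffvSl.
have kerP : ((P :\: A) :&: lker eps = 0)%VS.
  apply/eqP; rewrite -subv0; apply/subvP => v /memv_capP[vP]; rewrite memv_ker => /eqP e0.
  have vPP := subvP P'P _ vP.
  have /sumK : v \in (Y + E)%VS by move: vPP; rewrite memv_cap => /andP[].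
  rewrite e0 addr0 => vY.
  rewrite -(capv_diff P A) memv_cap vP /= memv_cap (subvP PX) //= -vY; exact: memv_pi.
have bd : basis_of (eps @: (P :\: A)) d by apply: limg_basis_of kerP (vbasisP _).
have dE : (<<d>> <= E)%VS.
  by apply/span_subvP => _ /mapP[v _ ->]; apply: memv_pi.
pose e := vbasis (E :\: <<d>>); pose y := vbasis (Y :\: Q).
pose t := vbasis ((E + X + Y)^C).
have spanvb (U : {vspace V}) : <<vbasis U>>%VS = U by apply: span_basis (vbasisP _).
have diffK (U U' : {vspace V}) : (U' <= U)%VS -> (U :\: U' + U' = U)%VS.
  by rewrite addv_diff => /addv_idPl.
have szdiff (U U' : {vspace V}) : (U' <= U)%VS -> (\dim (U :\: U') + \dim U' = \dim U)%N.
  by move=> /capv_idPr sU; rewrite -(dimv_cap_compl U U') sU addnC.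
have sa : size a = \dim A by rewrite size_tuple.
have sp : size p = \dim (P :\: A) by rewrite size_tuple.
have sx : size x = \dim (X :\: P) by rewrite size_tuple.
have sd : size d = size p by rewrite size_map.
have dd : \dim <<d>> = size p.
  by rewrite (span_basis bd) limg_dim_eq // sp.
have se : size e = \dim (E :\: <<d>>) by rewrite size_tuple.
have sy : size y = \dim (Y :\: Q) by rewrite size_tuple.
have st : size t = \dim ((E + X + Y)^C) by rewrite size_tuple.
have HP := szdiff _ _ AP; have HX := szdiff _ _ PX; have HE := szdiff _ _ dE.
have HY := szdiff Y Q (capvSl _ _).
have sX : <<a ++ p ++ x>>%VS = X.
  by rewrite !span_cat !spanvb addvA [(A + _)%VS]addvC diffK // addvC diffK.
have sE : <<d ++ e>>%VS = E by rewrite span_cat spanvb addvC diffK.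
have zsub : zip_sub p d = map psi p.
  rewrite /zip_sub /d; have : {subset tval p <= (Y + E)%VS}.
    move=> v /vbasis_mem vP; have := subvP P'P _ vP.
    by rewrite memv_cap => /andP[].
  elim: (tval p) => //= v s IH sub.
  have vYE : v \in (Y + E)%VS by apply: sub; rewrite mem_head.
  congr cons; first by apply/eqP; rewrite subr_eq sumK ?eqxx.
  by apply: IH => u us; apply: sub; rewrite inE us orbT.
have defQ : Q = (A + psi @: (P :\: A))%VS.
  apply/eqP; rewrite eqEsubv; apply/andP; split; last first.
    rewrite subv_add; apply/andP; split.
      by rewrite subv_cap capvSr /= (subv_trans _ (addvSl X E)) ?capvSl.
    apply/subvP => _ /memv_imgP[v vP ->]; have := subvP P'P _ vP.
    rewrite memv_cap => /andP[vX vYE]; rewrite memv_cap memv_pi /=.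
    have -> : psi v = v - eps v by apply/eqP; rewrite eq_sym subr_eq sumK ?eqxx.
    by rewrite memv_add // memvN memv_pi.
  apply/subvP => w /memv_capP[wY /memv_addP[v vX [f fE Hw]]].
  have Hv : v = w + - f by rewrite Hw addrK.
  have vP : v \in P by rewrite memv_cap vX Hv memv_add // memvN.
  have psiv u : u \in Y -> psi u = u by move=> uY; apply: daddv_pi_id.
  have psiE u : u \in E -> psi u = 0.
    move=> uE; have uYE : u \in (Y + E)%VS by rewrite (subvP (addvSr Y E)).
    by apply: (addIr (eps u)); rewrite sumK // add0r /eps daddv_pi_id.
  have psvw : psi v = w by rewrite Hv linearD /= psiv // psiE ?memvN // addr0.
  have : v \in (P :\: A + A)%VS by rewrite diffK.
  case/memv_addP => [v1 v1P [v2 v2A Hv2]].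
  rewrite -psvw Hv2 linearD /= addrC memv_add ?memv_img //.
  by rewrite psiv //; move: v2A; rewrite memv_cap => /andP[].
have sY : <<a ++ zip_sub p d ++ y>>%VS = Y.
  rewrite !span_cat zsub -limg_span !spanvb addvA.
  rewrite -defQ addvC diffK //.
  exact: capvSl.
have dEX : (\dim (E + X) = \dim E + \dim X)%N.
  by rewrite dimv_disjoint_sum // capvC.
have dEXY : (\dim (E + X + Y) + k = \dim E + \dim X + \dim Y)%N.
  by rewrite -dQ -dEX -(dimv_sum_cap (E + X) Y) [((E + X) :&: Y)%VS]capvC /Q [(X + E)%VS]addvC.
have dT : (size t + \dim (E + X + Y) = \dim {:V})%N.
  by rewrite st dimv_compl subnK // dimvS // subvf.
exists a, p, d, x, e, y, t; split=> //; last first.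
  rewrite dP in HX HP; rewrite dQ in HY; rewrite dd in HE.
  rewrite sd !sa sp sx se sy -/A HX HY -sp HE -HP sp addnC; split=> //.
rewrite basisEdim; apply/andP; split; last first.
  rewrite dP in HX HP; rewrite dQ in HY; rewrite dd in HE.
  rewrite !size_cat sd sa sp sx se sy; rewrite sp in HE.
  exact: adapted_arith HX HY HE HP dT dEXY.
rewrite -(addv_complf (E + X + Y)).
set B := (a ++ _); have sub s : {subset s <= B} -> (<<s>> <= <<B>>)%VS by apply: sub_span.
have XB : (X <= <<B>>)%VS.
  rewrite -{1}sX sub // => v; rewrite !mem_cat.
  by case/or3P => ->; rewrite ?orbT.
have EB : (E <= <<B>>)%VS.
  rewrite -{1}sE sub // => v; rewrite !mem_cat.
  by case/orP => ->; rewrite ?orbT.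
have yB : (Y :\: Q <= <<B>>)%VS.
  by rewrite -(spanvb (Y :\: Q)%VS) sub // => v; rewrite !mem_cat => ->; rewrite ?orbT.
have tB : ((E + X + Y)^C <= <<B>>)%VS.
  by rewrite -(spanvb (_ ^C)%VS) sub // => v; rewrite !mem_cat => ->; rewrite ?orbT.
rewrite !subv_add EB XB tB /= andbT -(diffK Y Q (capvSl _ _)) subv_add yB /=.
apply: subv_trans (capvSr _ _) _; by rewrite subv_add XB.
Qed.

Lemma zip_sub_map (g : 'End(V)) p d :
  map g (zip_sub p d) = zip_sub (map g p) (map g d).
Proof.
elim: p d => [|u p IH] [|v d] //=.
by rewrite /zip_sub /= linearB /= -!/(zip_sub _ _) IH.
Qed.

(* The stabilizer of E in GL(V) is transitive on the pairs (X, Y) with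
   prescribed dimensions. *)
Lemma config_transitive X Y X' Y' :
  (X :&: E = 0)%VS -> (Y :&: E = 0)%VS -> (X' :&: E = 0)%VS -> (Y' :&: E = 0)%VS ->
  \dim X = \dim X' -> \dim Y = \dim Y' ->
  \dim (X :&: Y) = \dim (X' :&: Y') ->
  \dim (pi @: X :&: pi @: Y) = \dim (pi @: X' :&: pi @: Y') ->
  exists g : 'End(V), [/\ lker g == 0%VS, (g @: E = E)%VS, (g @: X = X')%VS & (g @: Y = Y')%VS].
Proof.
move=> hX hY hX' hY' dX dY dI dP.
have [a [p [d [x [e [y [t [bB [sX sE sY] [za zp zd zx [ze zy]]]]]]]]]] := adapted_basis hX hY.
have [a' [p' [d' [x' [e' [y' [t' [bB' [sX' sE' sY'] [za' zp' zd' zx' [ze' zy']]]]]]]]]] :=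
  adapted_basis hX' hY'.
have ea : size a = size a' by lia.
have ep : size p = size p' by lia.
have ed : size d = size d' by lia.
have ex : size x = size x' by lia.
have ee : size e = size e' by lia.
have ey : size y = size y' by lia.
pose B := in_tuple (a ++ p ++ d ++ x ++ e ++ y ++ t).
have szB : \dim {:V} = size (a ++ p ++ d ++ x ++ e ++ y ++ t).
  exact: (@size_basis _ _ _ _ B bB).
have szB' := @size_basis _ _ _ _ (in_tuple (a' ++ p' ++ d' ++ x' ++ e' ++ y' ++ t')) bB'.
have eB := etrans (esym szB) szB'.
have [g Hg] := linear_of_free (a ++ p ++ d ++ x ++ e ++ y ++ t)
                              (a' ++ p' ++ d' ++ x' ++ e' ++ y' ++ t').
have {}Hg := Hg (basis_free bB) (esym eB).
pose h := linfun g.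
have Hh : map h (a ++ p ++ d ++ x ++ e ++ y ++ t) = a' ++ p' ++ d' ++ x' ++ e' ++ y' ++ t'.
  by rewrite -Hg; apply: eq_map => v; rewrite lfunE.
have split_cat s1 s2 s1' s2' : size s1 = size s1' ->
   map h (s1 ++ s2) = s1' ++ s2' -> map h s1 = s1' /\ map h s2 = s2'.
  move=> sz /eqP; rewrite map_cat eqseq_cat ?size_map //.
  by case/andP => /eqP -> /eqP ->.
have [ha /(split_cat _ _ _ _ ep)[hp]] := split_cat _ _ _ _ ea Hh.
case/(split_cat _ _ _ _ ed) => hd /(split_cat _ _ _ _ ex)[hx].
case/(split_cat _ _ _ _ ee) => he /(split_cat _ _ _ _ ey)[hy _].
have himg : limg h = fullv.
  by rewrite -[in LHS](span_basis bB) limg_span Hh (span_basis bB').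
exists h; split.
- have := limg_ker_dim h fullv; rewrite himg capfv => hk.
  by rewrite -dimv_eq0 -(eqn_add2r (\dim {:V})) add0n hk eqxx.
- by rewrite -{1}sE limg_span map_cat hd he.
- by rewrite -{1}sX limg_span !map_cat ha hp hx.
by rewrite -{1}sY limg_span !map_cat zip_sub_map ha hp hd hy.
Qed.

Lemma proj_cap_img (g : 'End(V)) X Y : lker g == 0%VS -> (g @: E = E)%VS ->
  \dim (pi @: (g @: X) :&: pi @: (g @: Y)) = \dim (pi @: X :&: pi @: Y).
Proof.
move=> g0 gE; apply/(@addIn (\dim E)); rewrite !dim_proj_cap -{1 2}gE -!limgD.
rewrite -lker0_img_cap // limg_dim_eq //.
by rewrite (eqP g0) capv0.
Qed.

End Configurations.

Section AttenuatedSpace.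
Variables (F : finFieldType) (V : vectType F) (W E : {vspace V}) (m : nat).

Definition Omega : finType := {X : {vspace V} | (\dim X == m) && (X :&: E == 0)%VS}.

Local Notation pi := (daddv_pi W E).

(* R_(i,j): dim(pi X :&: pi Y) = m - i and dim(X :&: Y) = m - i - j, without
   truncated subtraction; pi is the projection onto W along E. *)
Definition att_rel (ij : 'I_m.+1 * 'I_m.+1) : rel Omega := fun X Y =>
  (\dim (pi @: val X :&: pi @: val Y) + ij.1 == m)%N
  && (\dim (val X :&: val Y) + ij.1 + ij.2 == m)%N.

Hypothesis cWE : complementary W E.

Let dimO (X : Omega) : \dim (val X) = m.
Proof. by case: X => X /= /andP[/eqP]. Qed.

Let capO (X : Omega) : (val X :&: E)%VS = 0%VS.
Proof. by case: X => X /= /andP[_ /eqP]. Qed.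

Let dim_pi X : \dim (pi @: val (X : Omega)) = m.
Proof. by rewrite (dim_proj cWE (capO X)) dimO. Qed.

Let le_pi (X Y : Omega) : (\dim (pi @: val X :&: pi @: val Y) <= m)%N.
Proof. by apply: leq_trans (dimvS (capvSl _ _)) _; rewrite dim_pi. Qed.

Let att_arith (d c i j : nat) :
  (d + i = m -> c + i + j = m -> m - d = i /\ d - c = j)%N.
Proof. lia. Qed.

Lemma att_partition X Y : exists! ij, att_rel ij X Y.
Proof.
have h1 := le_pi X Y; have h2 := proj_cap_sub cWE (val Y) (capO X).
have hi : (m - \dim (pi @: val X :&: pi @: val Y) < m.+1)%N by lia.
have hj : (\dim (pi @: val X :&: pi @: val Y) - \dim (val X :&: val Y) < m.+1)%N.
  by lia.
exists (Ordinal hi, Ordinal hj); rewrite /att_rel; split=> [|[i j]] /=.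
  by apply/andP; rewrite subnKC // -addnA [(m - _ + _)%N]addnC addnA !subnKC.
case/andP=> /eqP H1 /eqP H2; have [] := att_arith H1 H2.
by move=> Hi Hj; congr pair; apply: val_inj.
Qed.

Lemma att_diag : exists i0, forall X Y, att_rel i0 X Y = (X == Y).
Proof.
exists (ord0, ord0) => X Y; rewrite /att_rel /= !addn0.
apply/andP/eqP => [[_ /eqP H]|<-]; last by rewrite !capvv dim_pi dimO eqxx.
apply: val_inj; apply/eqP; rewrite eqEdim !dimO leqnn andbT.
apply/capv_idPl/eqP; by rewrite eqEdim capvSl H dimO leqnn.
Qed.

Lemma att_sym ij : symmetric (att_rel ij).
Proof. by move=> X Y; rewrite /att_rel capvC [(val X :&: _)%VS]capvC. Qed.

Section Image.
Variables (g : 'End(V)) (g0 : lker g == 0%VS) (gE : (g @: E = E)%VS).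

Let img_subproof (X : Omega) :
  (\dim (g @: val X) == m) && (g @: val X :&: E == 0)%VS.
Proof.
rewrite limg_dim_eq ?(eqP g0) ?capv0 // dimO eqxx /=.
by rewrite -{2}gE -lker0_img_cap // capO limg0.
Qed.

Definition att_img (X : Omega) : Omega := Sub (g @: val X)%VS (img_subproof X).

Lemma att_img_inj : injective att_img.
Proof.
move=> X Y /(congr1 val)/= /eqP; rewrite eq_limg_ker0 // => /eqP; exact: val_inj.
Qed.

Lemma att_rel_img ij X Y : att_rel ij (att_img X) (att_img Y) = att_rel ij X Y.
Proof.
rewrite /att_rel /= proj_cap_img // -(lker0_img_cap _ _ g0) //.
rewrite [\dim (g @: _)%VS]limg_dim_eq //.
by rewrite (eqP g0) capv0.
Qed.

End Image.

Lemma att_regular i j k : exists p : nat, forall X Y,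
  att_rel k X Y -> #|[set Z | att_rel i X Z & att_rel j Z Y]| = p.
Proof.
case: (pickP (fun XY => att_rel k XY.1 XY.2)) => [[X0 Y0] /= H0|none]; last first.
  by exists 0 => X Y H; have := none (X, Y); rewrite /= H.
exists #|[set Z | att_rel i X0 Z & att_rel j Z Y0]| => X Y H.
have [g [g0 gE gX gY]] : exists g : 'End(V),
    [/\ lker g == 0%VS, (g @: E = E)%VS, (g @: val X0 = val X)%VS
      & (g @: val Y0 = val Y)%VS].
  apply: (config_transitive cWE); rewrite ?capO ?dimO //.
    case/andP: H0 => _ /eqP h0; case/andP: H => _ /eqP h.
    by apply/(@addIn k.1)/(@addIn k.2); apply: etrans h0 (esym h).
  case/andP: H0 => /eqP h0 _; case/andP: H => /eqP h _.
  by apply/(@addIn k.1); apply: etrans h0 (esym h).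
have eX : att_img g0 gE X0 = X by apply: val_inj.
have eY : att_img g0 gE Y0 = Y by apply: val_inj.
rewrite -(card_imset _ (@att_img_inj g g0 gE)); apply/eq_card => Z.
have [h hK hK'] : bijective (att_img g0 gE) by apply: injF_bij (@att_img_inj g g0 gE).
by rewrite -(hK' Z) mem_imset ?inE -?eX -?eY ?att_rel_img //; apply: att_img_inj.
Qed.

Definition attenuated_scheme : symScheme Omega ('I_m.+1 * 'I_m.+1)%type :=
  SymScheme att_partition att_diag att_sym att_regular.

End AttenuatedSpace.

(* Main.v *)
Require Import Defs.
From mathcomp Require Import all_boot all_order all_algebra.
From mathcomp Require Import finfield zify.

(** On [Omega_1] the relations only tell, for lines [s] and [x] outside [E],
    whether [s = x] and whether [s + E = x + E].  Hence [S] is class-resolving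
    exactly when it misses at most one point of each fibre of [X |-> X + E]:
    two missed points of the same fibre are never separated, while two points
    of different fibres are separated by any element of [S] in one of these
    fibres.  There are [(q^n - 1) / (q - 1)] fibres, all of size [q^l]. *)

Set Implicit Arguments.
Unset Strict Implicit.
Unset Printing Implicit Defensive.

Section FibreScheme.
Variables (T I U : finType) (A : symScheme T I) (f : T -> U) (k : nat).
Hypothesis label_fibre : forall s x y, (label A s x == label A s y) =
  ((s == x) == (s == y)) && ((f s == f x) == (f s == f y)).
Hypothesis card_fibre : forall x, #|[set y | f y == f x]| = k.

Lemma card_fibre_total : #|T| = #|f @: T| * k.
Proof.
rewrite -sum_nat_const -sum1_card (partition_big f (mem (f @: T))) /=; last first.
  by move=> x _; apply: imset_f.
apply: eq_bigr => _ /imsetP[x _ ->].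
by rewrite -(card_fibre x) -sum1_card; apply: eq_bigl => y; rewrite inE.
Qed.

Lemma class_resolving_compl_inj (S : {set T}) :
  class_resolving A S -> {in ~: S &, injective f}.
Proof.
move=> /class_resolvingP resS x y; rewrite !inE => xS yS fxy.
apply: resS => s sS; apply/eqP; rewrite label_fibre fxy eqxx andbT.
have /negPf -> : s != x by apply: contraNneq xS => <-.
by have /negPf -> : s != y by apply: contraNneq yS => <-.
Qed.

Lemma compl_inj_class_resolving (S : {set T}) :
  1 < k -> {in ~: S &, injective f} -> class_resolving A S.
Proof.
move=> k1 injS; apply/class_resolvingP => x y Hxy.
have [xS|xS] := boolP (x \in S).
  by have /eqP := Hxy x xS; rewrite label_fibre eqxx => /andP[/eqP/esym/eqP].
have [fxy|fxy] := eqVneq (f x) (f y).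
  have [yS|yS] := boolP (y \in S); last by apply: injS; rewrite ?inE.
  by have /eqP := Hxy y yS; rewrite label_fibre eqxx => /andP[/eqP/eqP/esym].
(* [1 < k] provides a second point [s] in the fibre of [x]. Since [x] is already missed there, [s]
   lies in [S], and it separates [x] from [y] by their fibres. *)
have : 0 < #|[set z | f z == f x] :\ x|.
  by have := cardsD1 x [set z | f z == f x]; rewrite card_fibre inE eqxx; lia.
case/card_gt0P=> s; rewrite !inE => /andP[sx /eqP fsx].
have sS : s \in S.
  apply: contraT => sS; case/eqP: sx; apply: injS => //; by rewrite inE.
have /eqP := Hxy s sS; rewrite label_fibre fsx eqxx => /andP[_ /eqP/esym].
by rewrite (negPf fxy).
Qed.

Lemma cdim_fibre : 1 < k -> cdim A = (k - 1) * #|f @: T|.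
Proof.
move=> k1; rewrite /cdim; case: ex_minnP => m /existsP[S /andP[resS /eqP <-]] minS.
apply/eqP; rewrite eqn_leq; apply/andP; split; last first.
  (* Lower bound: [f] embeds the complement of [S] into the set of fibres, and [T] has [k] points
     per fibre. *)
  have := card_in_imset (class_resolving_compl_inj resS).
  have : #|f @: ~: S| <= #|f @: T| by apply: subset_leq_card; apply: imsetS; apply/subsetP.
  have := cardsC S; have := card_fibre_total; nia.
(* Upper bound: remove from [T] one representative per fibre. The default of [odflt] is never
   reached, as [x] itself satisfies the predicate, so [r x] depends only on [f x]. *)
pose r x := odflt x [pick y | f y == f x].
have fr x : f (r x) = f x.
  by rewrite /r; case: pickP => [y /eqP //|/(_ x)]; rewrite eqxx.
have r_eq x y : f x = f y -> r x = r y.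
  by rewrite /r => ->; case: pickP => // /(_ y); rewrite eqxx.
have injr : {in r @: T &, injective f}.
  by move=> _ _ /imsetP[x _ ->] /imsetP[y _ ->]; rewrite !fr => /r_eq.
have fT : f @: (r @: T) = f @: T.
  by rewrite -imset_comp; apply: eq_imset => x; rewrite /= fr.
apply: minS; apply/existsP; exists (~: (r @: T)).
rewrite compl_inj_class_resolving ?setCK //=; apply/eqP.
have := cardsC (r @: T); rewrite card_fibre_total -(card_in_imset injr) fT.
by rewrite mulnBl mul1n mulnC => <-; rewrite addKn.
Qed.

End FibreScheme.

Import GRing.Theory.

(* [card_vspace] speaks of an explicitly packed [vectType], to which an abstract
   [V] only reduces after destruction. *)
Lemma card_finvect_vspace (F : finFieldType) (V : vectType F) (U : {vspace V}) :
  #|[set v : finvect_type V | v \in U]| = #|F| ^ \dim U.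
Proof.
case: V U => T c U.
rewrite -(@card_vspace F (finvect_type (Vector.Pack c)) c U).
by apply: eq_card => v; rewrite inE.
Qed.

Section Lines.
Variables (F : finFieldType) (V : vectType F) (E : {vspace V}).
Implicit Types (X Y : Omega E 1) (U : {vspace V}).

Lemma Omega1_dim X : \dim (val X) = 1.
Proof. by case: X => X /= /andP[/eqP]. Qed.

Lemma Omega1_cap X : (val X :&: E = 0)%VS.
Proof. by case: X => X /= /andP[_ /eqP]. Qed.

Lemma line_in_Omega1 (v : V) :
  v \notin E -> (\dim <[v]> == 1) && (<[v]> :&: E == 0)%VS.
Proof.
move=> vE; rewrite dim_vline.
have -> : v != 0%R by apply: contraNneq vE => ->; apply: mem0v.
rewrite -subv0; apply/subvP => w /memv_capP[/vlineP[c ->] cvE].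
have [->|c0] := eqVneq c 0%R; first by rewrite scale0r mem0v.
by rewrite rpredZeq (negPf c0) (negPf vE) in cvE.
Qed.

(** Double counting of pairs of a line [X] and a nonzero vector [v] of [X]: each vector of [U]
    outside [E] spans exactly one line counted on the left. *)
Lemma card_Omega1_sub U : (E <= U)%VS ->
  #|[set X : Omega E 1 | (val X <= U)%VS]| * (#|F| - 1) =
  #|F| ^ \dim U - #|F| ^ \dim E.
Proof.
move=> EU; pose vT := finvect_type V.
transitivity #|[set v : vT | v \in U] :\: [set v : vT | v \in E]|; last first.
  rewrite cardsD (setIidPr _) ?card_finvect_vspace //.
  by apply/subsetP => v; rewrite !inE; apply: (subvP EU).
rewrite -sum_nat_const -[RHS]sum1_card.
transitivity (\sum_(X in [set X : Omega E 1 | (val X <= U)%VS])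
  \sum_(v in [set v : vT | v \in U] :\: [set v : vT | v \in E] | v \in val X) 1).
  (* Since [X] meets [E] only in 0, its vectors outside [E] are its [#|F| - 1] nonzero ones. *)
  apply: eq_bigr => X; rewrite inE => XU.
  have X0 : ((0%R : V) : vT) \in [set v : vT | v \in val X] by rewrite inE; apply: mem0v.
  have := cardsD1 ((0%R : V) : vT) [set v : vT | v \in val X].
  rewrite X0 card_finvect_vspace Omega1_dim expn1 => ->; rewrite addKn -sum1_card.
  apply: eq_bigl => v; rewrite !inE.
  have [vX|] := boolP (v \in val X); rewrite ?andbF // !andbT (subvP XU) //.
  have <- : ((v : V) == 0%R) = ((v : V) \in E).
    by rewrite -memv0 -(Omega1_cap X) memv_cap (vX : (v : V) \in _).
  by rewrite andbT.
rewrite (exchange_big_dep (mem ([set v : vT | v \in U] :\: [set v : vT | v \in E]))) /=;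
  last by move=> X v _ /andP[].
apply: eq_bigr => v; rewrite !inE => /andP[vE vU].
rewrite (big_pred1 (Sub <[v : V]>%VS (line_in_Omega1 vE))) // => X.
rewrite !inE vE vU /= -val_eqE /=.
have d1 : \dim <[v : V]> = 1 by case/andP: (line_in_Omega1 vE) => /eqP.
apply/andP/eqP => [[XU vX]|->]; last by rewrite -!memvE memv_line.
by apply/esym/eqP; rewrite eqEdim -memvE vX Omega1_dim d1.
Qed.

Lemma Omega1_sub_eq X Y : (val X <= val Y)%VS = (X == Y).
Proof. by rewrite -val_eqE eqEdim !Omega1_dim leqnn andbT. Qed.

Lemma Omega1_sub_fibre X Y :
  (val X <= val Y + E)%VS = (val X + E == val Y + E)%VS.
Proof.
rewrite eqEdim !dimv_disjoint_sum ?Omega1_cap // !Omega1_dim leqnn andbT.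
by rewrite subv_add addvSr andbT.
Qed.

(** A line meets [U] in dimension 0 or 1; this turns the dimensions in the labels into booleans. *)
Lemma Omega1_dim_cap X U : \dim (val X :&: U) = (val X <= U)%VS.
Proof.
have [/capv_idPl ->|XU] := boolP (val X <= U)%VS; first exact: Omega1_dim.
have := dimvS (capvSl (val X) U); rewrite Omega1_dim.
case E1: (\dim _) => [|[|d]] // _; case/negP: XU; apply/capv_idPl/eqP.
by rewrite eqEdim capvSl Omega1_dim E1.
Qed.

End Lines.

(** For fixed [m], the index pair and the pair of intersection dimensions determine each other. *)
Lemma label_att_eq (F : finFieldType) (V : vectType F) (W E : {vspace V}) (m : nat)
    (cWE : complementary W E) (S X Y : Omega E m) :
  let pi := daddv_pi W E in
  (label (attenuated_scheme m cWE) S X == label (attenuated_scheme m cWE) S Y) =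
  (\dim (val S :&: val X) == \dim (val S :&: val Y)) &&
  (\dim (pi @: val S :&: pi @: val X) == \dim (pi @: val S :&: pi @: val Y)).
Proof.
have arith a b c d i j : c + i = m -> d + i + j = m ->
    (a + i == m) && (b + i + j == m) = (b == d) && (a == c) by lia.
move=> pi; set l := label _ S Y.
have : srel (attenuated_scheme m cWE) l S Y by rewrite -label_eq.
by rewrite label_eq /= /att_rel => /andP[/eqP h1 /eqP h2]; apply: arith h1 h2.
Qed.

Theorem proposition5p3 (p k q n l : nat) (F : finFieldType) (V : vectType F)
    (E W : {vspace V}) (hp : prime p) (hk : 0 < k) (hq : q = p ^ k)
    (hF : #|F| = q) (hn : 0 < n) (hl : 0 < l)
    (hV : \dim {:V} = n + l) (hE : \dim E = l) (hW : complementary W E) :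
  cdim (attenuated_scheme 1 hW) = (q ^ l - 1) * ((q ^ n - 1) %/ (q - 1)).
Proof.
have q1 : 1 < q by rewrite -hF; apply: finNzRing_gt1.
pose f (X : Omega E 1) : {vspace V} := (val X + E)%VS.
have ql1 : 1 < q ^ l by rewrite -{1}(exp1n l) ltn_exp2r.
(* The fibre of [X] consists of the lines inside [X + E], of dimension [l + 1], and
   [q ^ l.+1 - q ^ l = (q - 1) * q ^ l]. *)
have fibre X : #|[set Y | f Y == f X]| = q ^ l.
  have := card_Omega1_sub (addvSr (val X) E).
  rewrite dimv_disjoint_sum ?Omega1_cap // Omega1_dim hE hF add1n expnS.
  have -> : [set Y : Omega E 1 | (val Y <= val X + E)%VS] = [set Y | f Y == f X].
    by apply/setP => Y; rewrite !inE Omega1_sub_fibre.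
  rewrite -[X in _ = _ - X]mul1n -mulnBl mulnC => /eqP.
  by rewrite eqn_pmul2l ?subn_gt0 // => /eqP.
rewrite (@cdim_fibre _ _ _ _ f (q ^ l)) //; last first.
  (* [dim_half] eliminates the projection: its intersection dimension is that of [S] with [X + E],
     which is 1 exactly when [S] and [X] share a fibre. *)
  move=> S X Y; rewrite label_att_eq -!(dim_half hW) ?Omega1_cap //.
  have eqb (a b : bool) : (a == b :> nat) = (a == b) by case: a b => [] [].
  by rewrite !Omega1_dim_cap !eqb !Omega1_sub_eq !Omega1_sub_fibre.
congr (_ * _).
(* Counting all of [Omega_1] and cancelling the fibre size [q ^ l] gives the number of fibres. *)
have := card_Omega1_sub (subvf E); rewrite hV hE hF.
have -> : [set X : Omega E 1 | (val X <= fullv)%VS] = setT.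
  by apply/setP => X; rewrite !inE subvf.
rewrite cardsT (card_fibre_total fibre) expnD -[X in _ = _ - X]mul1n -mulnBl => /eqP.
rewrite mulnAC eqn_pmul2r ?(ltnW ql1) // => /eqP <-.
by rewrite mulnK // subn_gt0.
Qed.
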